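(* There exists a positive integer $v'$ such that for each integer $v\ge v'$, any graph that is cospectral with the Johnson graph $J(v,3)$ is the intersection graph of some linear $3$-uniform hypergraph.
   Context: All graphs are finite, undirected and simple. Two graphs are cospectral if their adjacency matrices have the same spectrum (as multisets of eigenvalues). For a set $X$ of size $v$ (with $v\ge 6$), the Johnson graph $J(v,3)$ has as vertices the $3$-subsets of $X$, two of them being adjacent iff they intersect in precisely $2$ elements. A hypergraph $H$ is a pair $(X,E)$ with $X$ a finite set (vertices) and $E$ a set of non-empty subsets of $X$ (edges). It is $h$-uniform ($h\ge 2$) if every edge has cardinality $h$; it is linear if every pair of distinct vertices is contained in at most one edge. The intersection graph of $H=(X,E)$ is the graph with vertex set $E$ in which two distinct edges $e,e'\in E$ are adjacent iff $e\cap e'\ne\emptyset$. Graphs are identified up to isomorphism. *)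

(* Defs.v *)
From HB Require Import structures.
From mathcomp Require Import all_boot all_order all_algebra all_field.

Set Implicit Arguments.
Unset Strict Implicit.
Unset Printing Implicit Defensive.

Import GRing.Theory.

Record sgraph := SGraph {
  vertex :> finType;
  adj : rel vertex;
  adj_sym : symmetric adj;
  adj_irr : irreflexive adj
}.

Definition graph_iso (G H : sgraph) : Prop :=
  exists2 f : G -> H, bijective f & forall x y : G, adj (f x) (f y) = adj x y.

Definition adjmx (G : sgraph) : 'M[algC]_#|G| :=
  (\matrix_(i, j) (adj (enum_val i) (enum_val j))%:R)%R.

(* The eigenvalues of an integer matrix are algebraic numbers, and [algC] is
   algebraically closed, so the spectrum loses nothing by being taken in [algC]
   instead of the field of all complex numbers. *)
Definition eigenmult n (A : 'M[algC]_n) (a : algC) : nat := mup a (char_poly A).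

Definition cospectral (G H : sgraph) : Prop :=
  forall a : algC, eigenmult (adjmx G) a = eigenmult (adjmx H) a.

Section Johnson.
Variable v : nat.

Definition triple := {A : {set 'I_v} | #|A| == 3}.

Definition johnson3_adj (A B : triple) : bool := #|val A :&: val B| == 2.

Lemma johnson3_sym : symmetric johnson3_adj.
Proof. by move=> A B; rewrite /johnson3_adj setIC. Qed.

Lemma johnson3_irr : irreflexive johnson3_adj.
Proof. by move=> A; rewrite /johnson3_adj setIid (eqP (valP A)). Qed.

Definition johnson3 : sgraph := SGraph johnson3_sym johnson3_irr.

End Johnson.

Record hypergraph := Hypergraph {
  hvertex : finType;
  hedges : {set {set hvertex}};
  hedges_nonempty : set0 \notin hedges
}.

Definition uniform (h : nat) (H : hypergraph) : Prop :=
  forall e : {set hvertex H}, e \in hedges H -> #|e| = h.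

Definition linear_hypergraph (H : hypergraph) : Prop :=
  forall (x y : hvertex H), x != y ->
  forall e f : {set hvertex H}, e \in hedges H -> f \in hedges H ->
  x \in e -> y \in e -> x \in f -> y \in f -> e = f.

Section IntersectionGraph.
Variable H : hypergraph.

Definition hedge := {e : {set hvertex H} | e \in hedges H}.

Definition intersection_adj (e f : hedge) : bool :=
  (e != f) && (val e :&: val f != set0).

Lemma intersection_sym : symmetric intersection_adj.
Proof. by move=> e f; rewrite /intersection_adj eq_sym setIC. Qed.

Lemma intersection_irr : irreflexive intersection_adj.
Proof. by move=> e; rewrite /intersection_adj eqxx. Qed.

Definition intersection_graph : sgraph :=
  SGraph intersection_sym intersection_irr.

End IntersectionGraph.

(* Main.v *)
Require Import Defs.
From mathcomp Require Import all_boot all_order all_algebra all_field.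
From mathcomp Require Import zify ring.

(* Let A be the adjacency matrix of J(v,3) and Y = A + 3, so that Y(S,R) is the
   number of 2-subsets of S :&: R. Counting gives
   (Y - 2(v-3)) Y (Y - (v-4)) = 36 J, which locates the spectrum. For a
   cospectral graph G it follows that A_G + 3 is positive semidefinite, that G
   is 3w-regular with w = v - 3, and that every neighbourhood spans exactly
   3w(w+1) ordered adjacent pairs.

   Positivity of A_G + 3 forbids independent 10-sets inside a neighbourhood,
   makes every vertex adjacent to almost all or almost none of a large clique,
   and makes two cliques behave alike as soon as one is almost joined to the
   other. By Ramsey's theorem N(x) is therefore covered, up to boundedly many
   vertices, by the near-cliques attached to a few large cliques, and the edge
   count forces three of them. Testing positivity against the vector
   T e_x - 1_K1 - 1_K2 - 1_K3, whose norm is nearly zero, shows that a vertex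
   z <> x is almost complete to exactly one of the K_i if it is adjacent to x
   and to none otherwise. Hence N(x) splits into three cliques, and two
   neighbours y, z of x lie in the same one iff x, y, z is a triangle with many
   common neighbours. This condition is symmetric in x, y, z, so the cliques are
   the lines of a partial linear space with three lines through each point. *)

Set Implicit Arguments.
Unset Strict Implicit.
Unset Printing Implicit Defensive.

Import Order.TTheory GRing.Theory Num.Theory.

(** * Hypergraphs from triangles *)

Section LinearSpace.
Variable G : sgraph.

Definition nbhd (x : G) : {set G} := [set y | adj x y].

Definition tri (t : nat) (x y z : G) : bool :=
  [&& adj x y, adj y z, adj z x & t <= #|nbhd x :&: nbhd y :&: nbhd z|].

Lemma triC t x y z : tri t x y z = tri t y x z.
Proof.
rewrite /tri [nbhd y :&: _]setIC (adj_sym y x) (adj_sym x z) (adj_sym z y).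
by case: adj => //=; rewrite !andbA [adj z x && _]andbC.
Qed.

Definition line (t : nat) (x y : G) : {set G} :=
  [set z | [|| z == x, z == y | tri t x y z]].

Lemma lineC t x y : line t x y = line t y x.
Proof. by apply/setP=> z; rewrite !inE triC orbCA. Qed.

(** Duality: a vertex x becomes the edge [E x], the set of its three lines, over the type of all
    vertex sets of [G]. As [tri] is symmetric, a line looks the same from each of its points, so
    distinct x and x' share a line iff they are adjacent, and then only [line t x x']. *)
Lemma intersection_graph_of_lines (t : nat) (c : G -> G -> 'I_3) :
  (forall x i, exists y, (y \in nbhd x) && (c x y == i)) ->
  (forall x y z, y \in nbhd x -> z \in nbhd x -> y != z ->
     (c x y == c x z) = tri t x y z) ->
  exists H : hypergraph,
    [/\ uniform 3 H, linear_hypergraph H & graph_iso G (intersection_graph H)].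
Proof.
move=> c_onto c_tri.
pose E x : {set {set G}} := [set line t x y | y in nbhd x].
have mem_line x y z : y \in nbhd x ->
    (z \in line t x y) = (z == x) || ((z \in nbhd x) && (c x z == c x y)).
  move=> xy; rewrite !inE; case: eqVneq => //= zx.
  case: eqVneq => [->|zy] /=; first by rewrite -[adj x y]in_set xy eqxx.
  case xz: (adj x z); last by rewrite /tri (adj_sym z x) xz !andbF.
  by rewrite [c x z == _]eq_sym c_tri // ?inE // eq_sym.
have lineE x y z : y \in nbhd x -> z \in nbhd x ->
    (line t x y == line t x z) = (c x y == c x z).
  move=> xy xz; apply/eqP/eqP=> [Eyz|Eyz].
    have: z \in line t x z by rewrite !inE eqxx orbT.
    rewrite -Eyz mem_line // xz /=; case/orP=> [/eqP zx|/eqP -> //].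
    by move: xz; rewrite inE zx adj_irr.
  by apply/setP=> u; rewrite !mem_line // Eyz.
have cardE x : #|E x| = 3.
  pose r i := xchoose (c_onto x i).
  have rN i : r i \in nbhd x by case/andP: (xchooseP (c_onto x i)).
  have rc i : c x (r i) = i by case/andP: (xchooseP (c_onto x i)) => _ /eqP.
  have ->: E x = [set line t x (r i) | i : 'I_3].
    apply/setP=> l; apply/imsetP/imsetP=> [[y xy ->]|[i _ ->]]; last by exists (r i).
    by exists (c x y) => //; apply/eqP; rewrite lineE // rc.
  rewrite card_imset ?card_ord // => i j /eqP; rewrite lineE // !rc; exact/eqP.
have Ecommon x x' l : x != x' -> l \in E x -> l \in E x' ->
    adj x x' /\ l = line t x x'.
  move=> nxx' /imsetP[y xy ->] /imsetP[y' xy' El].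
  have: x' \in line t x y by rewrite El !inE eqxx.
  rewrite mem_line // eq_sym (negPf nxx') /= => /andP[xx' cx'].
  by move: (xx'); rewrite inE => ->; split=> //; apply/eqP; rewrite lineE // eq_sym.
(* Equal edges would make all three lines through x coincide with [line t x x']. *)
have Einj : injective E.
  move=> x x' Exx'; apply/eqP/negPn/negP=> nxx'.
  have sub : E x \subset [set line t x x'].
    by apply/subsetP=> l lE; rewrite inE; case: (Ecommon x x' l); rewrite -?Exx' // => _ ->.
  by move: (subset_leq_card sub); rewrite cardE cards1.
have E0 : set0 \notin [set E x | x : G].
  by apply/imsetP=> -[x _ Ex]; move: (cardE x); rewrite -Ex cards0.
pose H := Hypergraph E0; exists H; split.
- by move=> e /imsetP[x _ ->].
- move=> l l' nll' e f /imsetP[x _ ->] /imsetP[x' _ ->] lx l'x lx' l'x'.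
  have [->//|nxx'] := eqVneq x x'.
  have [_ El] := Ecommon x x' l nxx' lx lx'.
  have [_ El'] := Ecommon x x' l' nxx' l'x l'x'.
  by case/eqP: nll'; rewrite El El'.
have EH x : E x \in hedges H by apply: imset_f.
pose f x : intersection_graph H := exist _ (E x) (EH x).
have finj : injective f by move=> x y [/Einj].
exists f.
  have g_ex (e : intersection_graph H) : exists x, f x == e.
    by case: e => e He; case/imsetP: (He) => x _ Ee; exists x; rewrite -val_eqE /= Ee.
  by exists (fun e => xchoose (g_ex e)) => x; last exact/eqP/(xchooseP (g_ex x));
    apply: finj; apply/eqP/(xchooseP (g_ex (f x))).
move=> x y; rewrite [LHS]/= /intersection_adj (inj_eq finj) /=.
have [->|nxy] := eqVneq x y; first by rewrite adj_irr.
apply/set0Pn/idP=> /= [[l]|xy].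
  by rewrite inE => /andP[lx ly]; case: (Ecommon x y l).
exists (line t x y); rewrite inE; apply/andP; split; first by apply: imset_f; rewrite inE.
by rewrite lineC; apply: imset_f; rewrite inE adj_sym.
Qed.

End LinearSpace.

(** * The quadratic form A + 3 *)

Section PositiveForm.
Variable G : sgraph.
Implicit Types (K L S : {set G}) (x y z : G).

Definition gram x y : nat := 3 * (x == y) + adj x y.

Lemma gramC x y : gram x y = gram y x.
Proof. by rewrite /gram eq_sym adj_sym. Qed.

(** For the form with <e_x, e_y> = [gram x y], [wdeg K x] is <1_K, e_x> and [wsum K L] below is
    <1_K, 1_L>. *)
Definition wdeg K x : nat := \sum_(y in K) gram x y.

Definition wsum K L : nat := \sum_(x in K) wdeg L x.

Lemma wsumC K L : wsum K L = wsum L K.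
Proof.
rewrite /wsum /wdeg exchange_big; apply: eq_bigr => x _.
by apply: eq_bigr => y _; rewrite gramC.
Qed.

Lemma wdeg1 x y : wdeg [set y] x = gram x y.
Proof. by rewrite /wdeg big_set1. Qed.

Lemma wsum1 x L : wsum [set x] L = wdeg L x.
Proof. by rewrite /wsum big_set1. Qed.

Lemma wdegE K x : wdeg K x = 3 * (x \in K) + #|nbhd x :&: K|.
Proof.
rewrite /wdeg big_split /= -big_distrr /=; congr (3 * _ + _).
  case xK: (x \in K); last first.
    by rewrite big1 // => y yK; case: eqP => // xy; rewrite xy yK in xK.
  rewrite (bigD1 x) //= eqxx big1 // => y /andP[_ yx].
  by rewrite eq_sym (negPf yx).
rewrite -sum1_card [RHS](eq_bigl (fun y => (y \in K) && adj x y)).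
  by rewrite [RHS]big_mkcondr; apply: eq_bigr => y _; case: adj.
by move=> y; rewrite !inE andbC.
Qed.

Definition clique K : Prop := {in K &, forall y z, y != z -> adj y z}.

Definition indep K : Prop := {in K &, forall y z, ~~ adj y z}.

Lemma clique_sub K L : K \subset L -> clique L -> clique K.
Proof. by move=> /subsetP KL cL y z yK zK; apply: cL; apply: KL. Qed.

Lemma wdeg_clique K x : clique K -> x \in K -> wdeg K x = #|K| + 2.
Proof.
move=> cK xK; rewrite wdegE xK (cardsD1 x K) xK.
suff ->: nbhd x :&: K = K :\ x by lia.
apply/setP=> y; rewrite !inE andbC; case yK: (y \in K); rewrite ?andbF ?andbT //=.
by have [->|nyx] := eqVneq y x; rewrite ?adj_irr // cK // eq_sym.
Qed.

Lemma wsum_clique K : clique K -> wsum K K = #|K| * (#|K| + 2).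
Proof.
move=> cK; rewrite /wsum (eq_bigr (fun _ => #|K| + 2)) => [|x xK].
  by rewrite sum_nat_const.
exact: wdeg_clique.
Qed.

Hypothesis psd : forall u : G -> int,
  (0 <= \sum_x \sum_y u x * u y * (gram x y)%:Z)%R.

(* Positivity at 3 u - c e_x, where u = \sum_(p <- s) p.1 * 1_(p.2) and
   c = <u, e_x>, i.e. Cauchy-Schwarz against a vector of norm 3. *)
Lemma cauchy_vertex (s : seq (int * {set G})) x :
  ((\sum_(p <- s) p.1 * (wdeg p.2 x)%:Z) ^+ 2 <=
   3 * \sum_(p <- s) \sum_(r <- s) p.1 * r.1 * (wsum p.2 r.2)%:Z)%R.
Proof.
set c := (X in (X ^+ 2 <= _)%R); set Q := (X in (_ <= 3 * X)%R).
pose chi K y : int := (y \in K)%:R%R.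
pose u y : int := (\sum_(p <- s) p.1 * chi p.2 y)%R.
pose Mu (w : G -> int) y : int := (\sum_z w z * (gram y z)%:Z)%R.
have chiE K y : Mu (chi K) y = (wdeg K y)%:Z%R.
  rewrite /Mu /chi /wdeg (big_morph Posz PoszD (erefl _)) /= [RHS]big_mkcond /=.
  by apply: eq_bigr => z _; case: (z \in K); rewrite ?mul1r ?mul0r.
have uE y : Mu u y = (\sum_(p <- s) p.1 * (wdeg p.2 y)%:Z)%R.
  rewrite /Mu /u; under eq_bigr do rewrite big_distrl /=.
  rewrite exchange_big /=; apply: eq_bigr => p _; rewrite -chiE big_distrr /=.
  by apply: eq_bigr => z _; rewrite mulrA.
have QE : (\sum_y u y * Mu u y = Q)%R.
  rewrite /Q /u; under eq_bigr do rewrite uE big_distrl /=.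
  rewrite exchange_big /=; apply: eq_bigr => p _.
  under eq_bigr do rewrite big_distrr /=.
  rewrite exchange_big /=; apply: eq_bigr => r _.
  rewrite /wsum (big_morph Posz PoszD (erefl _)) big_distrr [RHS]big_mkcond /=.
  apply: eq_bigr => z _; rewrite /chi; case: (z \in p.2).
    by rewrite mulr1 mulrA.
  by rewrite mulr0 mul0r.
have cE : Mu u x = c by rewrite uE.
move: c cE Q QE => c cE Q QE.
pose w y : int := (3 * u y - c * (y == x)%:R)%R.
have dE (f : G -> int) : (\sum_y (y == x)%:R * f y = f x)%R.
  rewrite (bigD1 x) //= eqxx mul1r big1 ?addr0 // => y /negPf ->.
  by rewrite mul0r.
have MwE y : Mu w y = (3 * Mu u y - c * (gram y x)%:Z)%R.
  rewrite /Mu /w; under eq_bigr do rewrite mulrBl -!mulrA.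
  rewrite sumrB -!big_distrr /=; congr (_ - _ * _)%R.
  exact: (dE (fun z => (gram y z)%:Z)%R).
have: (0 <= \sum_y w y * Mu w y)%R.
  have := psd w; congr (_ <= _)%R; apply: eq_bigr => y _.
  by rewrite /Mu big_distrr /=; apply: eq_bigr => z _; rewrite mulrA.
have ->: (\sum_y w y * Mu w y = 9 * Q - 3 * c ^+ 2)%R.
  have E1 : (\sum_y u y * (gram y x)%:Z = c)%R.
    by rewrite -cE /Mu; apply: eq_bigr => y _; rewrite gramC.
  transitivity (9 * (\sum_y u y * Mu u y) - 3 * c * (\sum_y u y * (gram y x)%:Z)
     - 3 * c * (\sum_y (y == x)%:R * Mu u y)
     + c ^+ 2 * (\sum_y (y == x)%:R * (gram y x)%:Z))%R.
    rewrite !big_distrr -!sumrB -big_split /=; apply: eq_bigr => y _.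
    rewrite MwE /w; ring.
  rewrite QE E1 !dE cE; have ->: gram x x = 3 by rewrite /gram eqxx adj_irr.
  ring.
lia.
Qed.

(** Here <1_S, e_x> = |S| and <1_S, 1_S> = 3|S|, so Cauchy-Schwarz reads |S|^2 <= 9|S|. *)
Lemma indep_nbhd x S : S \subset nbhd x -> indep S -> #|S| <= 9.
Proof.
move=> SN iS.
have := cauchy_vertex [:: (1%R, S)] x.
rewrite !big_cons !big_nil /=.
have ->: wdeg S x = #|S|.
  rewrite wdegE; have /setIidPr -> := SN; case xS: (x \in S) => //.
  by have := subsetP SN _ xS; rewrite inE adj_irr.
have ->: wsum S S = 3 * #|S|.
  rewrite /wsum (eq_bigr (fun=> 3)) ?sum_nat_const 1?mulnC // => y yS.
  rewrite wdegE yS; suff ->: nbhd y :&: S = set0 by rewrite cards0.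
  apply/setP=> z; rewrite !inE; case zS: (z \in S); rewrite ?andbF // andbT.
  exact/negbTE/iS.
nia.
Qed.

(* A clique with 13 neighbours and 13 non-neighbours of y would violate
   [cauchy_vertex]: a * b <= 6 * (a + b) fails for a, b >= 13. *)
Definition full K y : bool := #|K| <= wdeg K y + 12.

Lemma wdeg_not_full K y : clique K -> ~~ full K y -> wdeg K y <= 12.
Proof.
move=> cK; rewrite /full; case yK: (y \in K); first by rewrite wdeg_clique //; lia.
(* With a neighbours and b non-neighbours of y in K, these weights sum to zero over K. The norm is
   then only 2ab(a + b), and the inner product with e_y is ab. *)
have := cauchy_vertex [:: (#|K :\: nbhd y|%:Z, nbhd y :&: K);
                          (- #|nbhd y :&: K|%:Z, K :\: nbhd y)]%R y.
rewrite !big_cons !big_nil /=.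
have E1 : wdeg (nbhd y :&: K) y = #|nbhd y :&: K|.
  by rewrite wdegE !inE yK andbF setIA setIid.
have E2 : wdeg (K :\: nbhd y) y = 0.
  rewrite wdegE !inE yK andbF; suff ->: nbhd y :&: (K :\: nbhd y) = set0 by rewrite cards0.
  by apply/setP=> z; rewrite !inE; case: adj.
have c1 : clique (nbhd y :&: K) by apply: clique_sub cK; apply: subsetIr.
have c2 : clique (K :\: nbhd y) by apply: clique_sub cK; apply: subsetDl.
have E3 : wsum (nbhd y :&: K) (K :\: nbhd y) = #|nbhd y :&: K| * #|K :\: nbhd y|.
  rewrite /wsum (eq_bigr (fun=> #|K :\: nbhd y|)) ?sum_nat_const // => z.
  rewrite !inE => /andP[yz zK]; rewrite wdegE [z \in _ :\: _]inE inE yz muln0.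
  suff /setIidPr -> : K :\: nbhd y \subset nbhd z by [].
  apply/subsetP=> t; rewrite !inE => /andP[nyt tK].
  by apply: cK => //; apply: contra nyt => /eqP <-.
rewrite E1 E2 [wsum (K :\: _) (_ :&: _)]wsumC E3 !wsum_clique //.
have := cardsID (nbhd y) K; rewrite setIC.
rewrite wdegE yK.
move: #|nbhd y :&: K| #|K :\: nbhd y| #|K| => a b k <-.
have [//|a13] := leqP a 12; rewrite -ltnNge => H b13.
nia.
Qed.

(** Since L is almost joined to K, 1_L - 1_K has norm at most 2T(T + 2) - 2T(T - 12) = 28T. Hence
    the two weighted degrees of y differ by at most sqrt(84T), which is below T - 12. *)
Lemma full_stable K L y (T : nat) : 1000 <= T -> clique K -> #|K| = T ->
  clique L -> #|L| = T -> {in L, forall z, full K z} ->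
  wdeg L y < wdeg K y + (T - 12) /\ wdeg K y < wdeg L y + (T - 12).
Proof.
move=> T1000 cK eK cL eL fL.
have := cauchy_vertex [:: (1%R, L); (-1, K)]%R y.
rewrite !big_cons !big_nil /= [wsum K L]wsumC !wsum_clique // eK eL.
have: T * (T - 12) <= wsum L K.
  rewrite -{1}eL -sum_nat_const; apply: leq_sum => z /fL.
  by rewrite /full eK; lia.
move: (wsum L K) (wdeg L y) (wdeg K y) => m a b Hm H.
have {Hm}: T * T <= m + 12 * T by nia.
move=> Hm.
have {H}H: ((a%:Z - b%:Z) ^+ 2 <= 84 * T%:Z)%R by nia.
by split; nia.
Qed.

End PositiveForm.

(** * Ramsey's theorem for cliques and independent sets *)

Lemma ramsey (s t : nat) : exists R : nat, forall (G : sgraph) (S : {set G}),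
  R <= #|S| ->
  (exists K : {set G}, [/\ K \subset S, clique K & #|K| = s]) \/
  (exists I : {set G}, [/\ I \subset S, indep I & #|I| = t]).
Proof.
elim: s t => [|s IHs] t.
  exists 0 => G S _; left; exists set0.
  by split; rewrite ?sub0set ?cards0 // => y z; rewrite inE.
elim: t => [|t [R2 IHt]].
  exists 0 => G S _; right; exists set0.
  by split; rewrite ?sub0set ?cards0 // => y z; rewrite inE.
have [R1 {}IHs] := IHs t.+1.
exists (R1 + R2).+1 => G S RS.
have [x xS] : exists x, x \in S by apply/card_gt0P; lia.
have cardS : #|nbhd x :&: (S :\ x)| + #|(S :\ x) :\: nbhd x| = #|S|.-1.
  by rewrite setIC cardsID (cardsD1 x S) xS.
have sub (A : {set G}) : A \subset S :\ x -> A \subset S.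
  by move=> AS; apply: subset_trans AS (subsetDl _ _).
have [R1S|R2S] : R1 <= #|nbhd x :&: (S :\ x)| \/ R2 <= #|(S :\ x) :\: nbhd x| by lia.
  have [[K [KS cK eK]]|[I [IS iI eI]]] := IHs G _ R1S; last first.
    by right; exists I; split=> //; apply: sub; apply: subset_trans IS (subsetIr _ _).
  left; exists (x |: K).
  have KN z : z \in K -> adj x z by move/(subsetP KS); rewrite !inE => /andP[].
  have xK : x \notin K by apply/negP=> /KN; rewrite adj_irr.
  split; last by rewrite cardsU1 xK eK.
    rewrite subUset sub1set xS /=; apply: sub; exact: subset_trans KS (subsetIr _ _).
  move=> y z; rewrite !inE => /orP[/eqP->|yK] /orP[/eqP->|zK]; rewrite ?eqxx //.
  - by rewrite KN.
  - by rewrite adj_sym KN.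
  - exact: cK.
have [[K [KS cK eK]]|[I [IS iI eI]]] := IHt G _ R2S.
  by left; exists K; split=> //; apply: sub; apply: subset_trans KS (subsetDl _ _).
right; exists (x |: I).
have IN z : z \in I -> ~~ adj x z by move/(subsetP IS); rewrite !inE => /andP[].
have xI : x \notin I by apply/negP=> /(subsetP IS); rewrite !inE eqxx andbF.
split; last by rewrite cardsU1 xI eI.
  rewrite subUset sub1set xS /=; apply: sub; exact: subset_trans IS (subsetDl _ _).
move=> y z; rewrite !inE => /orP[/eqP->|yI] /orP[/eqP->|zI]; rewrite ?adj_irr //.
- by rewrite IN.
- by rewrite adj_sym IN.
- exact: iI.
Qed.

(** * Neighbourhoods *)

Section LocalStructure.
Variables (G : sgraph) (T R w : nat).
Implicit Types (I K L S U : {set G}) (x y z : G).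

Hypothesis psd : forall u : G -> int,
  (0 <= \sum_x \sum_y u x * u y * (gram x y)%:Z)%R.
Hypothesis T1000 : 1000 <= T.
Hypothesis ramseyR : forall S, R <= #|S| ->
  (exists K, [/\ K \subset S, clique K & #|K| = T]) \/
  (exists I, [/\ I \subset S, indep I & #|I| = 10]).
Hypothesis deg : forall x, #|nbhd x| = 3 * w.
Hypothesis triangles :
  forall x, \sum_(y in nbhd x) #|nbhd x :&: nbhd y| <= 3 * w * w.+1.
Hypothesis wR : 12 * R + 7 <= w.

Lemma clique_nbhd x S : S \subset nbhd x -> R <= #|S| ->
  exists K, [/\ K \subset S, clique K & #|K| = T].
Proof.
move=> SN /ramseyR[//|[I [IS iI eI]]].
have := indep_nbhd psd (subset_trans IS SN) iI; by rewrite eI.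
Qed.

(** Otherwise R non-neighbours of y in S contain a T-clique L of vertices full to K. Then [wdeg L y]
    = 0 while [wdeg K y] >= T - 12, against [full_stable]. *)
Lemma full_nonadj x K S y : clique K -> #|K| = T -> S \subset nbhd x ->
  {in S, forall z, full K z} -> full K y -> #|S :\: nbhd y :\ y| < R.
Proof.
move=> cK eK SN fS fy; rewrite ltnNge; apply/negP=> /(clique_nbhd (x := x))[|L [LS cL eL]].
  by apply: subset_trans SN; rewrite setDDl subsetDl.
have fL : {in L, forall z, full K z}.
  by move=> z /(subsetP LS); rewrite !inE => /and3P[_ _ /fS].
have [_] := full_stable psd y T1000 cK eK cL eL fL.
suff -> : wdeg L y = 0 by move: fy; rewrite /full eK; lia.
rewrite wdegE; case yL: (y \in L); first by move/(subsetP LS): yL; rewrite !inE eqxx.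
suff -> : nbhd y :&: L = set0 by rewrite cards0.
apply/setP=> z; rewrite !inE; apply/andP=> -[yz /(subsetP LS)].
by rewrite !inE yz andbF.
Qed.

(** The mirror image of [full_nonadj]: a T-clique L among the neighbours of y in S has [wdeg L y] >=
    T, while [wdeg K y] <= 12. *)
Lemma notfull_adj K S y : clique K -> #|K| = T ->
  {in S, forall z, full K z} -> ~~ full K y -> #|nbhd y :&: S| < R.
Proof.
move=> cK eK fS fy; rewrite ltnNge; apply/negP=> /(clique_nbhd (subsetIl _ _))[L [LS cL eL]].
have fL : {in L, forall z, full K z}.
  by move=> z /(subsetP LS); rewrite !inE => /andP[_ /fS].
have [+ _] := full_stable psd y T1000 cK eK cL eL fL.
have := wdeg_not_full psd cK fy.
have /setIidPr : L \subset nbhd y by apply: subset_trans LS (subsetIl _ _).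
rewrite (wdegE L) => ->; rewrite eL; lia.
Qed.

Lemma nearly_complete_degrees U : {in U, forall y, #|U :\: nbhd y :\ y| < R} ->
  #|U| * #|U| <= (\sum_(y in U) #|nbhd y :&: U|) + #|U| * R.
Proof.
move=> hU; rewrite -!sum_nat_const -big_split /=; apply: leq_sum => y yU.
have := hU y yU; have := cardsD1 y (U :\: nbhd y).
have := cardsID (nbhd y) U; rewrite setIC; lia.
Qed.

(* Two near-cliques covering almost all of the 3w neighbours of x would span
   about (3w)^2/2 > 3w(w+1) ordered adjacent pairs. *)
Lemma third_part_large x U1 U2 : U1 \subset nbhd x -> U2 \subset nbhd x ->
  [disjoint U1 & U2] ->
  {in U1, forall y, #|U1 :\: nbhd y :\ y| < R} ->
  {in U2, forall y, #|U2 :\: nbhd y :\ y| < R} ->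
  5 * R + 2 <= #|nbhd x :\: U1 :\: U2|.
Proof.
move=> U1N U2N dU h1 h2.
have := nearly_complete_degrees h1; have := nearly_complete_degrees h2.
have UN : U1 :|: U2 \subset nbhd x by rewrite subUset U1N.
have := cardsID (U1 :|: U2) (nbhd x); rewrite (setIidPr UN) deg -setDDl.
rewrite cardsU disjoint_setI0 // cards0 subn0 => cN s2 s1.
have st : \sum_(y in U1) #|nbhd y :&: U1| + \sum_(y in U2) #|nbhd y :&: U2|
    <= 3 * w * w.+1.
  apply: leq_trans (triangles x).
  rewrite [leqRHS](big_setID (U1 :|: U2)) /= (setIidPr UN).
  rewrite [X in _ <= X + _](eq_bigl [predU U1 & U2]) => [|y]; last by rewrite !inE.
  rewrite [X in _ <= X + _]bigU //=.
  apply: leq_trans (leq_addr _ _); apply: leq_add; apply: leq_sum => y _;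
    apply: subset_leq_card; rewrite setIC; exact: setSI.
move: s1 s2 cN st; move: (\sum_(y in U1) _) (\sum_(y in U2) _) => m1 m2.
move: #|U1| #|U2| #|_ :\: U2| => a b l s1 s2 cN st.
rewrite leqNgt; apply/negP=> lR.
have ab : (a + b) * (a + b) <= 2 * (a * a) + 2 * (b * b).
  by have [+ _] := nat_Cauchy a b; rewrite -!mulnn; lia.
have h : (a + b) * (a + b) <= 2 * (3 * w * w.+1) + 2 * ((a + b) * R) by lia.
move: (a + b) h cN => n h cN.
(* Since n >= 3w - (5R + 1), these bounds combine to 9w^2 <= 6w^2 + (36R + 12)w, that is w <= 12R +
   4, which [wR] excludes. *)
have k1 : (3 * w) * (3 * w) <= (3 * w) * (n + (5 * R + 1)) by apply: leq_mul; lia.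
have k2 : n * (3 * w) <= n * (n + (5 * R + 1)) by apply: leq_mul; lia.
have h3 : n * (5 * R + 1) <= 3 * w * (5 * R + 1) by apply: leq_mul; lia.
have h4 : n * R <= 3 * w * R by apply: leq_mul; lia.
have h5 : w * (12 * R + 7) <= w * w by apply: leq_mul.
lia.
Qed.

Lemma full_sum x K1 K2 K3 z :
  [/\ clique K1, #|K1| = T & K1 \subset nbhd x] ->
  [/\ clique K2, #|K2| = T & K2 \subset nbhd x] ->
  [/\ clique K3, #|K3| = T & K3 \subset nbhd x] ->
  {in K2, forall y, ~~ full K1 y} -> {in K3, forall y, ~~ full K1 y} ->
  {in K3, forall y, ~~ full K2 y} ->
  z != x -> full K1 z + full K2 z + full K3 z = adj x z.
Proof.
move=> [c1 e1 s1] [c2 e2 s2] [c3 e3 s3] f12 f13 f23 zx.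
have cross K L : clique K -> #|L| = T -> {in L, forall y, ~~ full K y} -> wsum L K <= 12 * T.
  move=> cK eL fL; rewrite -eL mulnC -sum_nat_const; apply: leq_sum => y /fL.
  exact: wdeg_not_full.
have wx K : #|K| = T -> K \subset nbhd x -> wdeg K x = T.
  move=> eK sK; rewrite wdegE (setIidPr sK) eK; case xK: (x \in K) => //.
  by move/(subsetP sK): xK; rewrite inE adj_irr.
have := cauchy_vertex psd [:: (T%:Z, [set x]); (-1, K1); (-1, K2); (-1, K3)]%R z.
rewrite !big_cons !big_nil /=.
rewrite (wsumC K1 [set x]) (wsumC K2 [set x]) (wsumC K3 [set x]) !wsum1.
rewrite (wx K1) // (wx K2) // (wx K3) //.
rewrite (wsum_clique c1) (wsum_clique c2) (wsum_clique c3) e1 e2 e3.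
rewrite (wsumC K1 K2) (wsumC K1 K3) (wsumC K2 K3).
have := cross _ _ c1 e2 f12; have := cross _ _ c1 e3 f13; have := cross _ _ c2 e3 f23.
have ->: wdeg [set x] x = 3 by rewrite wdeg1 /gram eqxx adj_irr.
have ->: wdeg [set x] z = adj x z by rewrite wdeg1 gramC /gram eq_sym (negPf zx).
move: (wsum _ _) (wsum _ _) (wsum _ _) => m1 m2 m3 h1 h2 h3 H.
set D : int := ((adj x z)%:Z * T%:Z - (wdeg K1 z)%:Z - (wdeg K2 z)%:Z
  - (wdeg K3 z)%:Z)%R.
(* The quadratic terms 3T^2 + 3T^2 - 6T^2 of the norm cancel. What remains is 6T from the cliques
   and at most 72T from the pairs of cliques, and 3 * 78 = 234. *)
have {H}H : (D * D <= 234 * T%:Z)%R by rewrite /D; lia.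
(* Each [wdeg Ki z] is at most 12 or at least T - 12, so |D| <= T/2 determines how many of the three
   are large. *)
have [D1 D2] : (2 * D <= T%:Z /\ - T%:Z <= 2 * D)%R.
  by clear -H T1000; split; nia.
have d1 := wdeg_not_full psd (y := z) c1.
have d2 := wdeg_not_full psd (y := z) c2.
have d3 := wdeg_not_full psd (y := z) c3.
move: d1 d2 d3 D1 D2; rewrite /D /full e1 e2 e3 {H D}.
move: (wdeg K1 z) (wdeg K2 z) (wdeg K3 z) => b1 b2 b3.
by case: (adj x z); lia.
Qed.

Definition part x (c : G -> 'I_3) i : {set G} := [set z in nbhd x | c z == i].

Lemma card_parts x (c : G -> 'I_3) S : S \subset nbhd x ->
  #|S| = \sum_i #|S :&: part x c i|.
Proof.
move=> SN; rewrite -sum1_card (partition_big c xpredT) //=.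
apply: eq_bigr => i _; rewrite sum1_card; apply: eq_card => z.
rewrite !inE unfold_in /=; case zS: (z \in S) => //=.
by have := subsetP SN _ zS; rewrite inE => ->.
Qed.

(** [third_part_large] serves twice: it leaves room for the second and third clique, and, applied to
    two of the final parts, it bounds the remaining one from below. The last clause also covers the
    non-neighbours of x. *)
Lemma nbhd_partition x : exists c : {ffun G -> 'I_3},
  [/\ forall i, 5 * R + 2 <= #|part x c i|,
      {in nbhd x, forall y, #|part x c (c y) :\: nbhd y :\ y| < R} &
      forall y i, y != x -> (y \in nbhd x -> c y != i) ->
        #|nbhd y :&: part x c i| < R].
Proof.
have subD (A B C D : {set G}) : A \subset D :\: B :\: C -> A \subset D.
  by rewrite !subsetD => /andP[/andP[]].
have [K1 [K1N c1 e1]] : exists K, [/\ K \subset nbhd x, clique K & #|K| = T].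
  by apply: clique_nbhd (subxx _) _; rewrite deg; lia.
pose U1 := [set z in nbhd x | full K1 z].
have U1N : U1 \subset nbhd x by apply/subsetP=> z; rewrite inE => /andP[].
have h1 : {in U1, forall y, #|U1 :\: nbhd y :\ y| < R}.
  move=> y; rewrite inE => /andP[_ fy]; apply: (full_nonadj c1 e1 U1N _ fy) => z.
  by rewrite inE => /andP[].
(* The empty set stands in for the second near-clique, so that [third_part_large] applies already
   here. *)
have [K2 [K2S c2 e2]] : exists K, [/\ K \subset nbhd x :\: U1 :\: set0, clique K & #|K| = T].
  apply: (clique_nbhd (x := x)); first exact: subD (subxx _).
  apply: leq_trans (third_part_large U1N (sub0set _) _ h1 _); first by lia.
    by rewrite disjoint_sym disjoints_subset sub0set.
  by move=> y; rewrite inE.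
pose U2 := [set z in nbhd x :\: U1 | full K2 z].
have U2N : U2 \subset nbhd x by apply/subsetP=> z; rewrite 2!inE => /andP[/andP[]].
have h2 : {in U2, forall y, #|U2 :\: nbhd y :\ y| < R}.
  move=> y; rewrite inE => /andP[_ fy]; apply: (full_nonadj c2 e2 U2N _ fy) => z.
  by rewrite inE => /andP[].
have [K3 [K3S c3 e3]] : exists K, [/\ K \subset nbhd x :\: U1 :\: U2, clique K & #|K| = T].
  apply: (clique_nbhd (x := x)); first exact: subD (subxx _).
  apply: leq_trans (third_part_large U1N U2N _ h1 h2); first by lia.
  by apply/pred0P=> z /=; rewrite !inE; case: adj => //=; case: full.
have {subD}fs z : z != x -> full K1 z + full K2 z + full K3 z = adj x z.
  apply: full_sum; first by split.
  - by split=> //; apply: subD K2S.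
  - by split=> //; apply: subD K3S.
  - by move=> y /(subsetP K2S); rewrite !inE => /and3P[_ + yx]; rewrite yx.
  - by move=> y /(subsetP K3S); rewrite !inE => /and3P[_ + yx]; rewrite yx.
  - move=> y /(subsetP K3S); rewrite !inE => /and3P[+ y1 yx].
    by move: y1; rewrite yx /= => ->.
pose K (i : 'I_3) := nth set0 [:: K1; K2; K3] i.
have cK i : clique (K i) by case: i => -[|[|[]]].
have eK i : #|K i| = T by case: i => -[|[|[]]].
(* By [fs], a neighbour of x full to neither [K1] nor [K2] is full to [K3]. Values outside [nbhd x]
   are cut off by [part]. *)
pose c : {ffun G -> 'I_3} :=
  [ffun z => if full K1 z then inord 0 else if full K2 z then inord 1 else inord 2].
have fc z i : z \in nbhd x -> full (K i) z = (c z == i).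
  move=> xz; have zx : z != x.
    by apply: contraTneq xz => ->; rewrite inE adj_irr.
  have := fs z zx; rewrite inE in xz; rewrite xz ffunE -val_eqE.
  case: i => -[|[|[|//]]] i3; rewrite /K /=;
    by case: full => //; case: full => //; case: full => //; rewrite inordK.
have fN z i : z != x -> z \notin nbhd x -> full (K i) z = false.
  move=> zx; rewrite inE => /negPf xz; have := fs z zx; rewrite xz.
  by case: i => -[|[|[|//]]] i3; rewrite /K /=; do 3!case: full.
have partN i : part x c i \subset nbhd x by apply/subsetP=> z; rewrite inE => /andP[].
have fpart i : {in part x c i, forall z, full (K i) z}.
  by move=> z; rewrite inE => /andP[xz]; rewrite fc.
have hpart i : {in part x c i, forall y, #|part x c i :\: nbhd y :\ y| < R}.
  by move=> y yi; apply: full_nonadj (cK i) (eK i) (partN i) (fpart i) (fpart i y yi).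
exists c; split.
- move=> i.
  have sz (j k : 'I_3) : i != j -> j != k -> i != k -> 5 * R + 2 <= #|part x c i|.
    move=> ij jk ik.
    have d : [disjoint part x c j & part x c k].
      apply/pred0P=> z /=; rewrite !inE; apply/negbTE/negP.
      by case/andP=> /andP[_ /eqP ->] /andP[_ /idPn].
    apply: leq_trans (third_part_large (partN j) (partN k) d (hpart j) (hpart k)) _.
    apply: subset_leq_card; apply/subsetP=> z; rewrite !inE => /and3P[+ + xz].
    rewrite xz /=; move: (c z) {d} ij jk ik => l; rewrite -!val_eqE /=.
    case: l i j k => [l Hl] [i' Hi] [j' Hj] [k' Hk] /=; lia.
  by case: i sz => -[|[|[|//]]] i3 sz;
    [apply: (sz (inord 1) (inord 2)) | apply: (sz (inord 0) (inord 2))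
    | apply: (sz (inord 0) (inord 1))]; rewrite -val_eqE /= !inordK.
- by move=> y xy; apply: hpart; rewrite inE xy eqxx.
- move=> y i yx yi; apply: notfull_adj (cK i) (eK i) (fpart i) _.
  by have [xy|xy] := boolP (y \in nbhd x); [rewrite fc // yi | rewrite fN].
Qed.

Lemma intersection_graph_of_local_structure : exists H : hypergraph,
  [/\ uniform 3 H, linear_hypergraph H & graph_iso G (intersection_graph H)].
Proof.
have [c hc] := fin_all_exists nbhd_partition.
have big x := let: And3 p _ _ := hc x in p.
have near x := let: And3 _ p _ := hc x in p.
have far x := let: And3 _ _ p := hc x in p.
have cardR x S : S \subset nbhd x ->
    (forall i, #|S :&: part x (c x) i| < R) -> #|S| < 3 * R.
  move=> SN SR; rewrite (card_parts (c x) SN) !big_ord_recl big_ord0.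
  by have := SR ord0; have := SR (lift ord0 ord0);
     have := SR (lift ord0 (lift ord0 ord0)); lia.
(* Nonadjacent y and z in one part P would have at least |P| - 2R >= 3R + 2 common neighbours in P.
   But z has fewer than R neighbours in each part at y, so there are fewer than 3R in all. *)
have part_clique x y z : y \in nbhd x -> z \in nbhd x -> c x y = c x z ->
    y != z -> adj y z.
  move=> xy xz cyz nyz; apply: contraT => nadj.
  have /cardR : nbhd y :&: nbhd z \subset nbhd y by apply: subsetIl.
  have Ry i : #|nbhd y :&: nbhd z :&: part y (c y) i| < R.
    apply: leq_ltn_trans (far y z i _ _); last 2 first.
    - by rewrite eq_sym.
    - by rewrite inE (negPf nadj).
    by apply: subset_leq_card; rewrite setSI ?subsetIr.
  move=> /(_ Ry).
  have := near x y xy; have := near x z xz; rewrite -cyz.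
  have := big x (c x y); set P := part _ _ _ => bP nz ny.
  have := cardsD1 y (P :\: nbhd y); have := cardsD1 z (P :\: nbhd z).
  have := cardsID (nbhd y) P; have := cardsID (nbhd z) (P :&: nbhd y).
  have : #|P :&: nbhd y :\: nbhd z| <= #|P :\: nbhd z|.
    by apply: subset_leq_card; rewrite setSD ?subsetIl.
  have : #|P :&: nbhd y :&: nbhd z| <= #|nbhd y :&: nbhd z|.
    by apply: subset_leq_card; rewrite -setIA subsetIr.
  lia.
(* The threshold 3R separates two cases: for y and z in one part at x, the rest of that part gives
   at least 5R common neighbours; otherwise there are fewer than 3R. *)
apply: (@intersection_graph_of_lines G (3 * R) c) => [x i|x y z xy xz nyz].
  have /card_gt0P[y] : 0 < #|part x (c x) i| by have := big x i; lia.
  by rewrite inE => yi; exists y.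
apply/eqP/idP=> [cyz|/and4P[_ yz _]].
  have yz := part_clique x y z xy xz cyz nyz.
  move: (xy) (xz); rewrite /tri !inE => -> xz'; rewrite yz adj_sym xz' /=.
  have : part x (c x) (c x y) :\ y :\ z \subset nbhd x :&: nbhd y :&: nbhd z.
    apply/subsetP=> u; rewrite !inE => /and4P[uz uy xu /eqP cu].
    have xu' : u \in nbhd x by rewrite inE.
    by rewrite xu !(part_clique x _ u) ?cu // eq_sym.
  move/subset_leq_card; apply: leq_trans.
  have := big x (c x y); rewrite (cardsD1 y) (cardsD1 z (_ :\ y)); lia.
apply: contraTeq => cyz; rewrite -ltnNge; apply: (cardR x).
  by rewrite -setIA subsetIl.
have Nx u : u \in nbhd x -> u != x by apply: contraTneq => ->; rewrite inE adj_irr.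
(* Part i misses y or z, and that vertex has fewer than R neighbours in it. *)
move=> i; have [ciy|ciy] := eqVneq (c x y) i.
  apply: leq_ltn_trans (far x z i (Nx z xz) _); last by rewrite -ciy eq_sym.
  by apply: subset_leq_card; rewrite setSI ?subsetIr.
apply: leq_ltn_trans (far x y i (Nx y xy) _) => //.
by apply: subset_leq_card; rewrite setSI // -setIA setIC -setIA subsetIl.
Qed.

End LocalStructure.

(** * Functions of a Hermitian matrix *)

Section SpectralCalculus.
Local Open Scope ring_scope.
Local Open Scope sesquilinear_scope.
Variables (n : nat) (A : 'M[algC]_n).
Hypothesis Aherm : A \is hermsymmx.

Definition spectrum : seq algC := [seq spectral_diag A 0 i | i <- enum 'I_n].

Definition fun_mx (f : algC -> algC) : 'M[algC]_n :=
  invmx (spectralmx A) *m diag_mx (map_mx f (spectral_diag A)) *m spectralmx A.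

Lemma fun_mx_id : fun_mx id = A.
Proof.
rewrite /fun_mx map_mx_id //.
by rewrite -(orthomx_spectralP (hermitian_normalmx Aherm)).
Qed.

Lemma fun_mxM f g : fun_mx f *m fun_mx g = fun_mx (fun a => f a * g a).
Proof.
rewrite /fun_mx !mulmxA mulmxK ?spectral_unit // -[_ *m diag_mx _ *m diag_mx _]mulmxA.
rewrite mulmx_diag; congr (_ *m diag_mx _ *m _).
by apply/rowP=> i; rewrite !mxE.
Qed.

Lemma fun_mxD f g : fun_mx f + fun_mx g = fun_mx (fun a => f a + g a).
Proof.
rewrite /fun_mx -mulmxDl -mulmxDr -raddfD /=; congr (_ *m diag_mx _ *m _).
by apply/rowP=> i; rewrite !mxE.
Qed.

Lemma fun_mx_const c : fun_mx (fun=> c) = c%:M.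
Proof.
have E : diag_mx (map_mx (fun=> c) (spectral_diag A)) = c%:M.
  by rewrite -diag_const_mx; congr diag_mx; apply/rowP=> i; rewrite !mxE.
by rewrite /fun_mx E mul_mx_scalar -scalemxAl mulVmx ?spectral_unit // scalemx1.
Qed.

Lemma fun_mxZ c f : c *: fun_mx f = fun_mx (fun a => c * f a).
Proof.
rewrite /fun_mx scalemxAl scalemxAr -linearZ /=; congr (_ *m diag_mx _ *m _).
by apply/rowP=> i; rewrite !mxE.
Qed.

Lemma fun_mx_shift c : A + c%:M = fun_mx (fun a => a + c).
Proof. by rewrite -{1}fun_mx_id -fun_mx_const fun_mxD. Qed.

Lemma eq_fun_mx f g : {in spectrum, f =1 g} -> fun_mx f = fun_mx g.
Proof.
move=> fg; congr (_ *m diag_mx _ *m _); apply/rowP=> i; rewrite !mxE.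
by apply: fg; apply: map_f; rewrite mem_enum.
Qed.

Lemma fun_mx_trace f : \tr (fun_mx f) = \sum_(a <- spectrum) f a.
Proof.
rewrite /fun_mx -mulmxA mxtrace_mulC -mulmxA mulmxV ?spectral_unit // mulmx1.
rewrite mxtrace_diag big_map big_enum /=.
by apply: eq_bigr => i _; rewrite mxE.
Qed.

Lemma char_poly_spectrum : char_poly A = \prod_(a <- spectrum) ('X - a%:P).
Proof.
have -> : char_poly A = char_poly (diag_mx (spectral_diag A)).
  rewrite /char_poly -[A in LHS]fun_mx_id /fun_mx map_mx_id //.
  set P := spectralmx A; set D := diag_mx _; pose f := map_mx (@polyC algC).
  have Pu : P \in unitmx by apply: spectral_unit.
  have -> : char_poly_mx (invmx P *m D *m P) = f _ _ (invmx P) *m char_poly_mx D *m f _ _ P.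
    rewrite /char_poly_mx mulmxBr mulmxBl -!map_mxM; congr (_ - _).
    by rewrite mul_mx_scalar -scalemxAl -map_mxM mulVmx // map_mx1 scalemx1.
  rewrite !det_mulmx mulrC mulrA -det_mulmx -map_mxM mulmxV //.
  by rewrite map_mx1 det1 mul1r.
rewrite char_poly_trig; last first.
  by apply/is_trig_mxP => i j ij; rewrite mxE -val_eqE ltn_eqF ?mulr0n.
rewrite /spectrum big_map big_enum /=; apply: eq_bigr => i _.
by rewrite mxE eqxx mulr1n.
Qed.

Lemma size_spectrum : size spectrum = n.
Proof. by rewrite size_map size_enum_ord. Qed.

Lemma eigenmult_spectrum a : eigenmult A a = count_mem a spectrum.
Proof. by rewrite /eigenmult char_poly_spectrum mu_prod_XsubC. Qed.

Lemma spectrum_eigenvalue a : a \in spectrum -> eigenvalue A a.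
Proof.
by rewrite eigenvalue_root_char char_poly_spectrum root_prod_XsubC.
Qed.

Lemma fun_mx_form f (u : 'rV[algC]_n) :
  (u *m fun_mx f *m u ^t*) 0 0 =
  \sum_i f (spectral_diag A 0 i) * `|(u *m (spectralmx A) ^t*) 0 i| ^+ 2.
Proof.
rewrite /fun_mx invmx_unitary ?spectral_unitarymx //.
set P := spectralmx A; set v := u *m P ^t*.
have -> : u *m (P ^t* *m diag_mx (map_mx f (spectral_diag A)) *m P) *m u ^t* =
    v *m diag_mx (map_mx f (spectral_diag A)) *m v ^t*.
  by rewrite /v trmx_mul map_mxM trmxCK !mulmxA.
rewrite mxE; apply: eq_bigr => i _.
by rewrite mul_mx_diag !mxE normCK mulrAC mulrC.
Qed.

Lemma fun_mx_psd f (u : 'rV[algC]_n) : {in spectrum, forall a, 0 <= f a} ->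
  0 <= (u *m fun_mx f *m u ^t*) 0 0.
Proof.
move=> f0; rewrite fun_mx_form; apply: sumr_ge0 => i _.
apply: mulr_ge0; last by rewrite exprn_ge0.
by apply: f0; apply: map_f; rewrite mem_enum.
Qed.

(** In an eigenbasis the form is a sum of nonnegative terms, so each term vanishes. This turns an
    extremal Rayleigh quotient into an eigenvector equation. *)
Lemma fun_mx_isotropic f (u : 'rV[algC]_n) : {in spectrum, forall a, 0 <= f a} ->
  (u *m fun_mx f *m u ^t*) 0 0 = 0 -> u *m fun_mx f = 0.
Proof.
move=> f0; have f0i i : 0 <= f (spectral_diag A 0 i).
  by apply: f0; apply: map_f; rewrite mem_enum.
rewrite fun_mx_form => /eqP; rewrite psumr_eq0 => [/allP h|i _]; last first.
  by rewrite mulr_ge0 ?exprn_ge0.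
rewrite /fun_mx invmx_unitary ?spectral_unitarymx // !mulmxA.
have -> : u *m (spectralmx A) ^t* *m diag_mx (map_mx f (spectral_diag A)) = 0.
  apply/rowP=> i; rewrite mul_mx_diag [LHS]mxE [RHS]mxE [map_mx f _ _ _]mxE.
  have := h i (mem_index_enum i); rewrite mulf_eq0 expf_eq0 /= normr_eq0.
  by case/orP=> /eqP ->; rewrite ?mul0r ?mulr0.
by rewrite mul0mx.
Qed.

End SpectralCalculus.

(** The sizes n and m are kept apart because equality of the orders of cospectral graphs is itself
    deduced from this. *)
Lemma cospectral_perm_spectrum n m (A : 'M[algC]_n) (B : 'M[algC]_m) :
  A \is hermsymmx -> B \is hermsymmx ->
  (forall a, eigenmult A a = eigenmult B a) ->
  perm_eq (spectrum A) (spectrum B).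
Proof.
move=> hA hB AB; apply/allP=> a _ /=.
by rewrite -!eigenmult_spectrum // AB.
Qed.

(** * Counting triples and pairs for J(v,3) *)

Lemma sum_pairs_through (T : finType) (A : {set T}) (a : T) : #|A| = 3 ->
  \sum_(P in [set P : {set T} | P \subset A & #|P| == 2]) (a \in P) = 2 * (a \in A).
Proof.
move=> A3; set D := [set P : {set T} | _].
have e : \sum_(P in D) (a \in P) + \sum_(P in D) (a \notin P) = 3.
  rewrite -big_split /= -[RHS](_ : #|D| = 3); last by rewrite cards_draws A3.
  by rewrite -sum1_card; apply: eq_bigr => P _; case: (a \in P).
(* The pairs avoiding a are those inside A minus a: one if a lies in A, three if not. *)
have e2 : \sum_(P in D) (a \notin P) = 'C(#|A :\ a|, 2).
  rewrite -cards_draws -sum1_card -big_mkcondr /=.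
  by apply: eq_bigl => P; rewrite !inE subsetD1 andbAC.
have := cardsD1 a A; move: e; rewrite e2 A3.
move: #|A :\ a| => m + h.
have -> : m = 3 - (a \in A) by lia.
have C32 : 'C(3, 2) = 3 by [].
by case: (a \in A); rewrite ?subn0 ?C32 ?binn; lia.
Qed.

Section JohnsonGraph.
Variable v : nat.
Hypothesis v4 : 4 <= v.
Implicit Types (X P : {set 'I_v}) (S R : johnson3 v).

Definition pts S : {set 'I_v} := sval S.

Lemma pts_inj : injective pts.
Proof. exact: val_inj. Qed.

Definition pairs S : {set {set 'I_v}} := [set P : {set 'I_v} | P \subset pts S & #|P| == 2].

Lemma card_triple S : #|pts S| = 3.
Proof. exact/eqP/(valP S). Qed.

Lemma card_pairs S : #|pairs S| = 3.
Proof. by rewrite cards_draws card_triple. Qed.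

(** The number of common pairs is a binomial coefficient with values 3, 1, 0 for equal, adjacent and
    remaining triples. *)
Lemma gram_johnson S R : gram S R = \sum_(P in pairs S) (P \subset pts R).
Proof.
have -> : \sum_(P in pairs S) (P \subset pts R) = 'C(#|pts S :&: pts R|, 2).
  rewrite -cards_draws -sum1_card -big_mkcondr /=.
  by apply: eq_bigl => P; rewrite !inE subsetI andbAC.
rewrite /gram [adj S R]/(#|pts S :&: pts R| == 2).
have [->|nSR] := eqVneq S R; first by rewrite setIid card_triple.
have : #|pts S :&: pts R| < 3.
  rewrite ltnNge; apply: contra nSR => h; rewrite -(inj_eq pts_inj) eqEcard !card_triple leqnn andbT.
  have /eqP <- : pts S :&: pts R == pts S by rewrite eqEcard subsetIl card_triple h.
  exact: subsetIr.
by case: #|_| => [|[|[|]]].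
Qed.

Definition triples_above X : nat := \sum_(R : johnson3 v) (X \subset pts R).

Lemma triples_aboveE X :
  triples_above X = #|[set A : {set 'I_v} | X \subset A & #|A| == 3]|.
Proof.
rewrite /triples_above -big_mkcond /= sum1dep_card -(card_imset _ pts_inj).
apply: eq_card => A; rewrite !inE; apply/imsetP/andP=> [[R]|[XA A3]].
  by rewrite inE => XR ->; rewrite card_triple.
by exists (exist _ A A3); rewrite ?inE.
Qed.

Lemma triples_above2 X : #|X| = 2 -> triples_above X = v - 2.
Proof.
move=> X2; rewrite triples_aboveE.
have -> : v - 2 = #|~: X| by rewrite cardsCs setCK X2 card_ord.
have <- : #|(fun a => a |: X) @: ~: X| = #|~: X|.
  apply: card_in_imset => a b; rewrite !inE => aX bX ab.
  have : a \in b |: X by rewrite -ab !inE eqxx.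
  by rewrite !inE (negPf aX) orbF => /eqP.
apply: eq_card => A; rewrite inE; apply/andP/imsetP=> [[XA /eqP A3]|[a]]; last first.
  by rewrite inE => aX ->; rewrite subsetUr cardsU1 aX X2.
have : 0 < #|A :\: X| by have := cardsID X A; rewrite (setIidPr XA); lia.
case/card_gt0P=> a; rewrite inE => /andP[aX aA]; exists a; first by rewrite inE.
apply/esym/eqP; rewrite eqEcard subUset sub1set aA XA A3 cardsU1 aX X2 //.
Qed.

Lemma triples_above3 X : #|X| = 3 -> triples_above X = 1.
Proof.
move=> X3; rewrite triples_aboveE -[RHS](cards1 X); apply: eq_card => A; rewrite !inE.
apply/andP/eqP=> [[XA /eqP A3]|->]; last by rewrite subxx X3.
by apply/esym/eqP; rewrite eqEcard XA A3 X3.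
Qed.

Lemma triples_above4 X : 3 < #|X| -> triples_above X = 0.
Proof.
move=> X4; rewrite triples_aboveE; apply: eq_card0 => A; rewrite inE.
by apply/negbTE/negP=> /andP[/subset_leq_card XA /eqP A3]; lia.
Qed.

Lemma pairs_through S (a : 'I_v) :
  \sum_(P in pairs S) (a \in P) = 2 * (a \in pts S).
Proof. exact: sum_pairs_through (card_triple S). Qed.

Lemma gram_johnson_sum S : \sum_R gram S R = 3 * (v - 2).
Proof.
under eq_bigr do rewrite gram_johnson; rewrite exchange_big /=.
rewrite (eq_bigr (fun=> v - 2)) => [|P]; first by rewrite sum_nat_const card_pairs.
by rewrite inE => /andP[_ /eqP]; apply: triples_above2.
Qed.

Lemma sum_mem2 (A B : {set 'I_v}) :
  \sum_a (a \in A) * (a \in B) = #|A :&: B|.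
Proof.
rewrite -sum1_card [RHS]big_mkcond /=; apply: eq_bigr => a _.
by rewrite inE; case: (a \in A); case: (a \in B).
Qed.

(** The left side counts triples above P :|: P' for pairs P of S and P' of S'. There are v - 2, 1 or
    0 of them as |P :&: P'| is 2, 1 or 0, that is (v - 4)[P = P'] + |P :&: P'|. Counting the last
    term point by point gives a factor 2 * 2 for each common point. *)
Lemma gram_johnson_sqr S S' :
  \sum_R gram S R * gram R S' = (v - 4) * gram S S' + 4 * #|pts S :&: pts S'|.
Proof.
transitivity (\sum_(P in pairs S) \sum_(P' in pairs S') triples_above (P :|: P')).
  rewrite /triples_above; under [RHS]eq_bigr do rewrite exchange_big /=.
  rewrite [RHS]exchange_big /=; apply: eq_bigr => R _.
  rewrite (@gramC (johnson3 v) R) !gram_johnson big_distrl /=; apply: eq_bigr => P _.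
  by rewrite big_distrr /=; apply: eq_bigr => P' _; rewrite subUset; do 2!case: (_ \subset _).
transitivity (\sum_(P in pairs S) \sum_(P' in pairs S')
    ((v - 4) * (P == P') + #|P :&: P'|)).
  apply: eq_bigr => P; rewrite inE => /andP[_ /eqP P2].
  apply: eq_bigr => P'; rewrite inE => /andP[_ /eqP P2'].
  have [<-|nPP'] := eqVneq P P'; first by rewrite setUid setIid triples_above2 // P2; lia.
  have cU : #|P :|: P'| + #|P :&: P'| = 4 by rewrite cardsUI P2 P2'.
  have : #|P :&: P'| < 2.
    rewrite ltnNge; apply: contra nPP' => h; rewrite eqEcard P2 P2' leqnn andbT.
    have /eqP <- : P :&: P' == P by rewrite eqEcard subsetIl P2 h.
    exact: subsetIr.
  rewrite muln0 add0n; move: cU.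
  case: #|P :&: P'| => [|[|//]] cU _.
    by rewrite triples_above4 //; lia.
  by rewrite triples_above3 //; lia.
under eq_bigr do rewrite big_split /= -big_distrr /=.
rewrite big_split /= -big_distrr /=; congr (_ * _ + _).
  rewrite gram_johnson; apply: eq_bigr => P; rewrite inE => /andP[_ P2].
  have [PS'|PS'] := boolP (P \subset pts S').
    rewrite (bigD1 P) ?inE ?PS' //= eqxx big1 // => P' /andP[_].
    by rewrite eq_sym => /negPf ->.
  rewrite big1 // => P'; rewrite inE => /andP[P'S' _].
  by case: eqP => // PP'; rewrite PP' P'S' in PS'.
under eq_bigr do under eq_bigr do rewrite -sum_mem2.
under eq_bigr do rewrite exchange_big /=.
rewrite exchange_big /= -sum_mem2 big_distrr /=; apply: eq_bigr => a _.
transitivity ((\sum_(P in pairs S) (a \in P)) * (\sum_(P in pairs S') (a \in P))).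
  by rewrite big_distrl; apply: eq_bigr => P _; rewrite big_distrr.
by rewrite !pairs_through; case: (a \in pts S); case: (a \in pts S').
Qed.

(** The left side counts triples above a |: P for a in S' and P a pair of S: v - 2 if a is in P, and
    1 otherwise. *)
Lemma gram_johnson_meet S S' :
  \sum_R gram S R * #|pts R :&: pts S'| = 2 * (v - 3) * #|pts S :&: pts S'| + 9.
Proof.
transitivity (\sum_(P in pairs S) \sum_(a in pts S') triples_above (a |: P)).
  rewrite /triples_above; under [RHS]eq_bigr do rewrite exchange_big /=.
  rewrite [RHS]exchange_big /=; apply: eq_bigr => R _.
  rewrite gram_johnson big_distrl /=; apply: eq_bigr => P _.
  rewrite -sum_mem2 big_distrr [RHS]big_mkcond /=; apply: eq_bigr => a _.
  by rewrite subUset sub1set; case: (a \in pts R); case: (a \in pts S'); case: (_ \subset _).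
transitivity (\sum_(P in pairs S) \sum_(a in pts S') ((v - 3) * (a \in P) + 1)).
  apply: eq_bigr => P; rewrite inE => /andP[_ /eqP P2]; apply: eq_bigr => a _.
  case aP: (a \in P); last by rewrite triples_above3 ?cardsU1 ?aP ?P2 //; lia.
  by rewrite (setUidPr _) ?sub1set // triples_above2 //; lia.
under eq_bigr do rewrite big_split /= -big_distrr /= sum1_card card_triple.
rewrite big_split /= -big_distrr sum_nat_const card_pairs /=; congr (_ + _).
rewrite exchange_big /= -sum_mem2 big_distrr /= big_distrr big_mkcond /=.
apply: eq_bigr => a _; rewrite pairs_through.
by case: (a \in pts S'); case: (a \in pts S) => /=; lia.
Qed.

Lemma card_johnson : #|johnson3 v| = 'C(v, 3).
Proof.
rewrite -[in RHS](card_ord v) -card_draws -(card_imset _ pts_inj).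
apply: eq_card => A; rewrite !inE; apply/imsetP/idP=> [[R _ ->]|A3]; first exact: (valP R).
by exists (exist _ A A3).
Qed.

End JohnsonGraph.

(** * Matrices and vectors indexed by the vertices of a graph *)

Section GraphMatrices.
Local Open Scope ring_scope.
Local Open Scope sesquilinear_scope.
Variable G : sgraph.
Implicit Types (f g : G -> G -> algC) (u : G -> algC) (x y z : G).

Definition graph_mx f : 'M[algC]_#|G| := \matrix_(i, j) f (enum_val i) (enum_val j).

Definition graph_row u : 'rV[algC]_#|G| := \row_i u (enum_val i).

Lemma sum_vertices (F : G -> algC) : \sum_(i < #|G|) F (enum_val i) = \sum_x F x.
Proof. by rewrite -(big_enum_val F); apply: eq_bigl. Qed.

Lemma adjmxE : adjmx G = graph_mx (fun x y => (adj x y)%:R).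
Proof. by []. Qed.

Lemma adjmx_hermitian : adjmx G \is hermsymmx.
Proof.
apply: realsym_hermsym.
  apply/is_hermitianmxP; rewrite expr0 scale1r map_mx_id //.
  by apply/matrixP=> i j; rewrite !mxE adj_sym.
by apply/mxOverP=> i j; rewrite mxE realn.
Qed.

Lemma graph_mxM f g :
  graph_mx f *m graph_mx g = graph_mx (fun x y => \sum_z f x z * g z y).
Proof.
apply/matrixP=> i j; rewrite !mxE.
by rewrite -(sum_vertices (fun z => f (enum_val i) z * g z (enum_val j)));
  apply: eq_bigr => k _; rewrite !mxE.
Qed.

Lemma graph_mx_trace f : \tr (graph_mx f) = \sum_x f x x.
Proof.
by rewrite /mxtrace -(sum_vertices (fun x => f x x)); apply: eq_bigr => i _; rewrite mxE.
Qed.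

Lemma graph_rowM u f :
  graph_row u *m graph_mx f = graph_row (fun y => \sum_x u x * f x y).
Proof.
apply/rowP=> j; rewrite !mxE.
by rewrite -(sum_vertices (fun z => u z * f z (enum_val j)));
  apply: eq_bigr => k _; rewrite !mxE.
Qed.

Lemma graph_form u f w :
  (graph_row u *m graph_mx f *m (graph_row w)^T) 0 0 = \sum_x \sum_y u x * w y * f x y.
Proof.
rewrite graph_rowM mxE exchange_big /=.
rewrite -(sum_vertices (fun y => \sum_x u x * w y * f x y)).
apply: eq_bigr => i _; rewrite !mxE big_distrl /=.
by apply: eq_bigr => x _; rewrite mulrAC.
Qed.

Lemma adjmx_shift3 : adjmx G + 3%:R%:M = graph_mx (fun x y => (gram x y)%:R).
Proof.
apply/matrixP=> i j; rewrite !mxE /gram natrD natrM addrC (inj_eq enum_val_inj).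
by rewrite mulr_natr.
Qed.

Lemma graph_row_conj u : (forall x, u x \is Num.real) ->
  (graph_row u) ^t* = (graph_row u)^T.
Proof. by move=> ur; apply/matrixP=> i j; rewrite !mxE; apply/CrealP. Qed.

Lemma card_nbhd_natr x : \sum_y ((adj x y)%:R : algC) = #|nbhd x|%:R.
Proof.
rewrite -sum1_card natr_sum [RHS]big_mkcond /=; apply: eq_bigr => y _.
by rewrite inE; case: adj.
Qed.

Lemma adjmx_sqr_diag x :
  \sum_y ((adj x y)%:R * (adj y x)%:R : algC) = #|nbhd x|%:R.
Proof.
rewrite -card_nbhd_natr; apply: eq_bigr => y _.
by rewrite (adj_sym y); case: adj; rewrite ?mulr1 ?mulr0.
Qed.

Lemma adjmx_cube_diag x :
  \sum_z (\sum_y (adj x y)%:R * (adj y z)%:R) * (adj z x)%:R =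
  (\sum_(y in nbhd x) #|nbhd x :&: nbhd y|)%N%:R :> algC.
Proof.
rewrite natr_sum [RHS]big_mkcond /=.
under eq_bigr do rewrite big_distrl /=.
rewrite exchange_big /=; apply: eq_bigr => y _; rewrite inE.
case: (adj x y); last by rewrite big1 // => z _; rewrite !mul0r.
rewrite -sum1_card natr_sum [RHS]big_mkcond /=; apply: eq_bigr => z _.
by rewrite !inE (adj_sym z x); case: (adj x z); case: (adj y z); rewrite /= ?mulr0 ?mulr1.
Qed.

End GraphMatrices.

(** * The spectrum of J(v,3) *)

Section JohnsonSpectrum.
Local Open Scope ring_scope.
Variable u : nat.
Local Notation J := (johnson3 (u + 4)).
Local Notation Y := (adjmx J + 3%:R%:M).

Let meet_mx : 'M[algC]_#|J| := graph_mx (fun S R : J => #|pts S :&: pts R|%:R).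

Let v4 : (4 <= u + 4)%N.
Proof. by rewrite leq_addl. Qed.

(** With v = u + 4 the coefficients v - 4, 2(v - 3) and 3(v - 2) become u, 2(u + 1) and 3(u + 2),
    free of truncated subtraction. *)
Lemma johnson_gram_sqr : Y *m Y = u%:R *: Y + 4%:R *: meet_mx.
Proof.
rewrite adjmx_shift3 graph_mxM; apply/matrixP=> i j; rewrite !mxE.
rewrite -!natrM -natrD; set S := enum_val i; set R := enum_val j.
have := gram_johnson_sqr v4 S R; rewrite addnK => <-.
by rewrite natr_sum; apply: eq_bigr => x _; rewrite natrM.
Qed.

Lemma johnson_gram_meet :
  Y *m meet_mx = (2 * (u + 1))%:R *: meet_mx + const_mx 9%:R.
Proof.
rewrite adjmx_shift3 graph_mxM; apply/matrixP=> i j; rewrite !mxE.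
rewrite -!natrM -natrD; set S := enum_val i; set R := enum_val j.
have := gram_johnson_meet v4 S R; rewrite (_ : u + 4 - 3 = u + 1)%N; last by lia.
move=> <-.
by rewrite natr_sum; apply: eq_bigr => x _; rewrite natrM.
Qed.

Lemma johnson_gram_const c : Y *m const_mx c = (3 * (u + 2))%:R *: const_mx c :> 'M[algC]_#|J|.
Proof.
rewrite adjmx_shift3; apply/matrixP=> i j; rewrite !mxE.
have := gram_johnson_sum v4 (enum_val i); rewrite (_ : u + 4 - 2 = u + 2)%N; last by lia.
move=> <-; rewrite natr_sum big_distrl /=.
rewrite -(sum_vertices (fun R : J => (gram (enum_val i) R)%:R * c)).
by apply: eq_bigr => k _; rewrite !mxE.
Qed.

(** Eliminating [meet_mx]: Y(Y - u) is 4 times it, and Y - 2(u + 1) sends it to the constant matrix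
    9. *)
Lemma johnson_gram_cubic :
  (Y - (2 * (u + 1))%:R%:M) *m (Y *m (Y - u%:R%:M)) = const_mx 36%:R.
Proof.
have -> : Y *m (Y - u%:R%:M) = 4%:R *: meet_mx.
  by rewrite mulmxBr johnson_gram_sqr mul_mx_scalar addrC addKr.
rewrite -scalemxAr mulmxBl johnson_gram_meet mul_scalar_mx.
rewrite [X in _ *: X]addrC addKr.
by apply/matrixP=> i j; rewrite !mxE -natrM.
Qed.

(** The cubic of [johnson_gram_cubic] in the adjacency eigenvalue a = b - 3, each factor written as
    a shift of a to fit [fun_mx_shift]. *)
Definition cubic (a : algC) : algC :=
  (a + (3%:R - (2 * (u + 1))%:R)) * ((a + 3%:R) * (a + (3%:R - u%:R))).

Lemma fun_mx_cubic n (A : 'M[algC]_n) : A \is hermsymmx ->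
  fun_mx A cubic =
    (A + 3%:R%:M - (2 * (u + 1))%:R%:M) *m
      ((A + 3%:R%:M) *m (A + 3%:R%:M - u%:R%:M)).
Proof.
move=> hA; rewrite -!addrA -!raddfB /= !fun_mx_shift //.
by rewrite !fun_mxM.
Qed.

(** Y - 3(u + 2) kills constant matrices, so every eigenvalue of Y is a root of this factor times
    the cubic. *)
Lemma johnson_spectrum a : a \in spectrum (adjmx J) ->
  [\/ a + 3%:R = 0, a + 3%:R = u%:R, a + 3%:R = (2 * (u + 1))%:R |
      a + 3%:R = (3 * (u + 2))%:R].
Proof.
move=> /(spectrum_eigenvalue (adjmx_hermitian J)) /eigenvalueP[w wa w0].
set b := a + 3%:R.
have wY : w *m Y = b *: w by rewrite mulmxDr wa mul_mx_scalar -scalerDl.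
have wshift c : w *m (Y - c%:M) = (b - c) *: w.
  by rewrite mulmxBr wY mul_mx_scalar scalerBl.
have h1 : ((b - (2 * (u + 1))%:R) * (b * (b - u%:R))) *: w = w *m const_mx 36%:R.
  rewrite -johnson_gram_cubic !mulmxA wshift -!scalemxAl wY -!scalemxAl wshift.
  by rewrite !scalerA !mulrA.
have h2 : (b - (3 * (u + 2))%:R) *: (w *m const_mx 36%:R : 'rV_#|J|) = 0.
  have := congr1 (mulmx w) (johnson_gram_const 36%:R).
  rewrite mulmxA wY -scalemxAl -scalemxAr => E.
  by rewrite scalerBl E subrr.
move/eqP: h2; rewrite -h1 scalerA scaler_eq0 (negPf w0) orbF.
rewrite !mulf_eq0 !subr_eq0 => /or4P[] /eqP ->;
  by [apply: Or44 | apply: Or43 | apply: Or41 | apply: Or42].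
Qed.

Lemma cubic_ge0 a : a \in spectrum (adjmx J) -> 0 <= cubic a.
Proof.
have cE b : a + 3%:R = b -> cubic a = (b - (2 * (u + 1))%:R) * (b * (b - u%:R)).
  by move=> <-; rewrite /cubic !addrA.
case/johnson_spectrum=> /cE ->.
- by rewrite !mul0r mulr0.
- by rewrite subrr !mulr0.
- by rewrite subrr mul0r.
- by rewrite -!natrB; try lia; rewrite -!natrM ler0n.
Qed.

Lemma johnson_ge_m3 a : a \in spectrum (adjmx J) -> 0 <= a + 3%:R.
Proof. by case/johnson_spectrum=> ->; rewrite ?ler0n. Qed.

Lemma johnson_le_valency a : a \in spectrum (adjmx J) -> 0 <= (3 * (u + 1))%:R - a.
Proof.
have cE b : a + 3%:R = b -> (3 * (u + 1))%:R - a = (3 * (u + 2))%:R - b.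
  move=> <-; rewrite (_ : 3 * (u + 2) = 3 * (u + 1) + 3)%N; last by lia.
  by rewrite natrD; ring.
by case/johnson_spectrum=> /cE ->; rewrite ?subr0 ?subr_ge0 ?ler_nat ?ler0n //; lia.
Qed.

Lemma johnson_degree (S : J) : #|nbhd S| = (3 * (u + 1))%N.
Proof.
have := gram_johnson_sum v4 S; rewrite (_ : u + 4 - 2 = u + 2)%N; last by lia.
have -> : (\sum_R gram S R = wdeg setT S)%N.
  by rewrite /wdeg; apply: eq_bigl => R; rewrite inE.
rewrite wdegE setIT inE /=; lia.
Qed.

Lemma johnson_spectrum_sqr :
  \sum_(a <- spectrum (adjmx J)) a * a = (#|J| * (3 * (u + 1)))%:R.
Proof.
rewrite -(fun_mx_trace (adjmx J)) -fun_mxM fun_mx_id ?adjmx_hermitian //.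
rewrite {1 2}adjmxE graph_mxM graph_mx_trace.
under eq_bigr do rewrite adjmx_sqr_diag johnson_degree.
by rewrite sumr_const [RHS]natrM [RHS]mulr_natl.
Qed.

Lemma johnson_spectrum_cubic :
  \sum_(a <- spectrum (adjmx J)) cubic a = (36 * #|J|)%:R.
Proof.
rewrite -(fun_mx_trace (adjmx J)) fun_mx_cubic ?adjmx_hermitian //.
rewrite johnson_gram_cubic /mxtrace.
under eq_bigr do rewrite mxE.
by rewrite sumr_const card_ord natrM mulr_natr.
Qed.

End JohnsonSpectrum.

(** * Graphs cospectral with J(v,3) *)

Section CospectralJohnson.
Local Open Scope ring_scope.
Local Open Scope sesquilinear_scope.
Variables (u : nat) (G : sgraph).
Local Notation J := (johnson3 (u + 4)).
Local Notation A := (adjmx G).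
Hypothesis GJ : cospectral G J.

Let Aherm : A \is hermsymmx := adjmx_hermitian G.

Let spectrumJ : perm_eq (spectrum A) (spectrum (adjmx J)).
Proof. exact: cospectral_perm_spectrum (adjmx_hermitian G) (adjmx_hermitian J) GJ. Qed.

Lemma cospectral_card : #|G| = #|J|.
Proof. by have := perm_size spectrumJ; rewrite !size_spectrum. Qed.

Lemma cospectral_psd (f : G -> int) :
  0 <= \sum_x \sum_y f x * f y * (gram x y)%:Z.
Proof.
pose g (x : G) : algC := (f x)%:~R.
have : 0 <= (graph_row g *m fun_mx A (fun a => a + 3%:R) *m (graph_row g) ^t*) 0 0.
  apply: fun_mx_psd => // a; rewrite (perm_mem spectrumJ); exact: johnson_ge_m3.
rewrite -fun_mx_shift // adjmx_shift3 graph_row_conj => [|x]; last exact: realz.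
rewrite graph_form -(ler_int algC) rmorph_sum /=; congr (_ <= _).
apply: eq_bigr => x _; rewrite rmorph_sum /=; apply: eq_bigr => y _.
by rewrite !rmorphM.
Qed.

Let ones : 'rV[algC]_#|G| := graph_row (fun=> 1).

(** Regularity from the spectrum: 3(u + 1) - A is positive semidefinite, and the entries of A sum to
    the trace of A^2, namely |J| * 3(u + 1). So the all-ones vector is isotropic, hence in the
    kernel. *)
Let ones_adjmx : ones *m A = (3 * (u + 1))%:R *: ones.
Proof.
pose f a : algC := (3 * (u + 1))%:R + -1 * a.
have E : fun_mx A f = (3 * (u + 1))%:R%:M - A.
  by rewrite -fun_mxD -fun_mxZ fun_mx_const fun_mx_id // scaleN1r.
suff : ones *m fun_mx A f = 0.
  by rewrite E mulmxBr mul_mx_scalar => /eqP; rewrite subr_eq0 => /eqP.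
apply: fun_mx_isotropic.
  move=> a; rewrite (perm_mem spectrumJ) /f mulN1r; exact: johnson_le_valency.
have Asqr : \sum_(x : G) \sum_y ((adj x y)%:R : algC) = (#|J| * (3 * (u + 1)))%:R :> algC.
  rewrite -johnson_spectrum_sqr -(perm_big _ spectrumJ) /= -(fun_mx_trace A).
  rewrite -fun_mxM fun_mx_id // adjmxE graph_mxM graph_mx_trace.
  by apply: eq_bigr => x _; rewrite adjmx_sqr_diag card_nbhd_natr.
rewrite E mulmxBr mulmxBl /ones graph_row_conj => [|x]; last exact: rpred1.
rewrite [LHS]mxE [X in _ + X]mxE adjmxE graph_form.
under [X in _ - X]eq_bigr do under eq_bigr do rewrite !mul1r.
rewrite Asqr mul_mx_scalar -scalemxAl !mxE.
rewrite (eq_bigr (fun=> 1)) => [|i _]; last by rewrite !mxE mulr1.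
by rewrite sumr_const card_ord cospectral_card [(#|_| * _)%:R]natrM mulrC subrr.
Qed.

Lemma cospectral_degree (x : G) : #|nbhd x| = (3 * (u + 1))%N.
Proof.
apply/eqP; rewrite -(eqr_nat algC) -card_nbhd_natr.
have /rowP/(_ (enum_rank x)) := ones_adjmx.
rewrite /ones adjmxE graph_rowM !mxE enum_rankK mulr1 => <-.
by apply/eqP/eq_bigr => y _; rewrite mul1r adj_sym.
Qed.

(** At the valency the three factors are u + 4, 3(u + 2) and 2(u + 3), with product 36 'C(u + 4,
    3). *)
Let ones_fun_cubic : ones *m fun_mx A (cubic u) = (36 * #|G|)%:R *: ones.
Proof.
have shift c : ones *m (A + c%:M) = ((3 * (u + 1))%:R + c) *: ones.
  by rewrite mulmxDr ones_adjmx mul_mx_scalar -scalerDl.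
have -> : fun_mx A (cubic u) =
    (A + (3%:R - (2 * (u + 1))%:R)%:M) *m ((A + 3%:R%:M) *m (A + (3%:R - u%:R)%:M)).
  by rewrite !fun_mx_shift // !fun_mxM.
rewrite !mulmxA shift -!scalemxAl shift -scalemxAl shift !scalerA; congr (_ *: _).
have C3 : (6 * 'C(u + 4, 3) = (u + 4) * (u + 3) * (u + 2))%N.
  by rewrite mulnC -[6%N]/(3`!) bin_ffact addn4 ffactnS ffactnS ffactn1; lia.
rewrite cospectral_card card_johnson (_ : 36 = 6 * 6)%N // -mulnA C3 !(natrM, natrD).
ring.
Qed.

(** The cubic Q of A is positive semidefinite with row sums 36 |G|, which forces every diagonal
    entry to be at least 36. Its trace is 36 |G|, so equality holds throughout. *)
Let cubic_diag (x : G) :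
  fun_mx A (cubic u) (enum_rank x) (enum_rank x) = 36%:R.
Proof.
set i := enum_rank x.
set Q := fun_mx A (cubic u).
have Qpsd (w : 'rV[algC]_#|G|) : 0 <= (w *m Q *m w ^t*) 0 0.
  by apply: fun_mx_psd => // a; rewrite (perm_mem spectrumJ); apply: cubic_ge0.
have QT : Q^T = Q.
  have AT : A^T = A by apply/matrixP=> i' j; rewrite !mxE adj_sym.
  have trS c : (A + c%:M)^T = A + c%:M by rewrite raddfD /= tr_scalar_mx AT.
  have -> : Q = (A + (3%:R - (2 * (u + 1))%:R)%:M) *m
      ((A + 3%:R%:M) *m (A + (3%:R - u%:R)%:M)).
    by rewrite !fun_mx_shift // !fun_mxM.
  rewrite !trmx_mul !trS !fun_mx_shift // !fun_mxM.
  by apply: eq_fun_mx => a _; ring.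
have Qrow j : \sum_k Q j k = (36 * #|G|)%:R.
  have /rowP/(_ j) := ones_fun_cubic; rewrite !mxE mulr1 => <-.
  by apply: eq_bigr => k _; rewrite -/Q -[in LHS]QT !mxE mul1r.
have n0 : (0 < #|G|)%N by apply/card_gt0P; exists x.
have ge36 j : 0 <= Q j j - 36%:R.
  pose N : algC := #|G|%:R.
  (* This vector is orthogonal to the all-ones vector, and its Q-norm is N^2 (Q j j - 36). *)
  pose w : 'rV[algC]_#|G| := N *: delta_mx 0 j - ones.
  have wT : w ^t* = w^T.
    apply/matrixP=> k l; rewrite !mxE; apply/CrealP.
    by rewrite rpredB ?rpred1 // rpredM ?realn.
  have N0 : 0 < N by rewrite ltr0n.
  rewrite -(pmulr_rge0 _ (mulr_gt0 N0 N0)).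
  suff <- : (w *m Q *m w ^t*) 0 0 = N * N * (Q j j - 36%:R) by apply: Qpsd.
  rewrite wT mulmxBl -scalemxAl -rowE ones_fun_cubic mxE.
  transitivity (\sum_k ((N * N * Q j k - 36%:R * N * N) * (k == j)%:R
     - (N * Q j k - 36%:R * N))).
    apply: eq_bigr => k _; rewrite !mxE eqxx /= natrM -/N; ring.
  rewrite sumrB (bigD1 j) //= eqxx big1 => [|k /negPf ->]; last by rewrite mulr0.
  rewrite sumrB -big_distrr /= Qrow sumr_const card_ord -[_ *+ #|G|]mulr_natr natrM -/N.
  ring.
have : \sum_j (Q j j - 36%:R) = 0.
  rewrite sumrB -/(mxtrace Q) fun_mx_trace (perm_big _ spectrumJ) /=.
  rewrite johnson_spectrum_cubic sumr_const card_ord cospectral_card natrM mulr_natr.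
  by rewrite subrr.
move/eqP; rewrite psumr_eq0 // => /allP /(_ i (mem_index_enum i)) /=.
by rewrite subr_eq0 => /eqP.
Qed.

(** Expanding the diagonal entry 36 of the cubic leaves (A^3)_xx as the only unknown: A^2
    contributes the degree and A contributes 0. *)
Lemma cospectral_triangles (x : G) :
  (\sum_(y in nbhd x) #|nbhd x :&: nbhd y| = 3 * (u + 1) * (u + 1).+1)%N.
Proof.
apply/eqP; rewrite -(eqr_nat algC) -adjmx_cube_diag; apply/eqP.
have := cubic_diag x.
pose c2 : algC := 7%:R - 3%:R * u%:R.
pose c1 : algC := (3%:R - (2 * (u + 1))%:R) * 3%:R + 3%:R * (3%:R - u%:R)
   + (3%:R - (2 * (u + 1))%:R) * (3%:R - u%:R).
pose c0 : algC := 3%:R * (3%:R - (2 * (u + 1))%:R) * (3%:R - u%:R).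
rewrite (@eq_fun_mx _ _ (cubic u) (fun a => a * a * a + (c2 * (a * a) + (c1 * a + c0))));
  last first.
  by move=> a _; rewrite /cubic /c2 /c1 /c0 !natrM !natrD; ring.
rewrite -!fun_mxD -fun_mxZ -fun_mxZ fun_mx_const -!fun_mxM fun_mx_id //.
rewrite adjmxE !graph_mxM !mxE enum_rankK eqxx adj_irr adjmx_sqr_diag cospectral_degree.
rewrite mulr1n mulr0 add0r => h.
rewrite (_ : (_ * _.+1)%:R = 36%:R - c2 * (3 * (u + 1))%:R - c0).
  by rewrite -h; ring.
by rewrite /c2 /c0 -addn1 !(natrM, natrD); ring.
Qed.

End CospectralJohnson.

Theorem theorem1p7 :
  exists v' : nat, 0 < v' /\
    forall v : nat, 6 <= v -> v' <= v ->
    forall G : sgraph, cospectral G (johnson3 v) ->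
    exists H : hypergraph,
      [/\ uniform 3 H, linear_hypergraph H & graph_iso G (intersection_graph H)].
Proof.
(* T must be large enough for 84T < (T - 12)^2 in [full_stable] and 4 * 234 < T in [full_sum]. *)
have [T T1000] : exists T, 1000 <= T by exists 1000.
have [R hR] := ramsey T 10.
(* Here w = v - 3, so the local analysis gets its bound 12R + 7 <= w. *)
exists (12 * R + 10); split=> [|v _]; first by rewrite addn_gt0 orbT.
move=> hv G; rewrite (_ : v = v - 4 + 4); last by lia.
set u := v - 4 => GJ.
apply: (@intersection_graph_of_local_structure G T R (u + 1)) => //.
- exact: cospectral_psd GJ.
- exact: hR.
- exact: cospectral_degree GJ.
- by move=> x; rewrite (cospectral_triangles GJ).
- by rewrite /u; lia.
Qed.
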